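(* Let $p \ge 2$, $0<q<p$, $T\ge 1$, $K\ge 1$ be integers, let $\{w_t\}_{t\in\mathbb{Z}_{\ge 0}}\subset\mathbb{R}^p$ be a sequence of data samples, let $\alpha_t>0$ ($t\ge T-1$) be step sizes, and for $t\ge T-1$ let $W_t=[w_{t-T+1}\ \cdots\ w_t]\in\mathbb{R}^{p\times T}$. Let $\mathcal{A}_1$ be the FRONT algorithm on $\mathrm{Flag}(p,(q))$ (the FRONT algorithm with $d=1$ and signature $(p,(q))$), and let $\mathcal{A}_2$ be the GREAT algorithm on $\mathrm{Gr}(p,q)$, both run with the same $T$, $K$, $\{w_t\}$ and $\{\alpha_t\}$. Then $\mathcal{A}_1$ is equivalent to $\mathcal{A}_2$; that is, if $\{\hat{\mathbf{U}}^t\}_{t\ge T-1}$ and $\{\hat{\mathbf{V}}^t\}_{t\ge T-1}$ denote the sequences of iterates generated by $\mathcal{A}_1$ and $\mathcal{A}_2$ respectively, then equality of the initial points $\hat{\mathbf{U}}^{T-1}=\hat{\mathbf{V}}^{T-1}$ implies $\hat{\mathbf{U}}^{t}=\hat{\mathbf{V}}^{t}$ for all $t\ge T$.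
   Context: **Manifolds.** $\mathrm{Gr}(p,q)$ is the Grassmannian of $q$-dimensional linear subspaces of $\mathbb{R}^p$. For $q_{1:d}=(q_1,\dots,q_d)$ with $0<q_1<\cdots<q_d<p$, $\mathrm{Flag}(p,q_{1:d})$ is the manifold of flags $\mathbf{U}_{1:d}$, i.e. nested sequences of linear subspaces $\{0\}\subset\mathbf{U}_1\subset\cdots\subset\mathbf{U}_d\subset\mathbb{R}^p$ with $\dim\mathbf{U}_j=q_j$. In particular $\mathrm{Flag}(p,(q))=\mathrm{Gr}(p,q)$ as a set (and manifold). $\Pi_{\mathbf{U}}$ denotes the orthogonal projector of $\mathbb{R}^p$ onto the subspace $\mathbf{U}$, and $\|\cdot\|_F$ the Frobenius norm. **Riemannian metrics.** Both manifolds carry their standard metrics. With $q_0=0$ and $q_{d+1}=p$, $\mathrm{Flag}(p,q_{1:d})$ is identified with the quotient $O(p)/\big(O(q_1-q_0)\times\cdots\times O(q_{d+1}-q_d)\big)$. A tangent vector at the flag represented by $Q\in O(p)$ is represented by $QX$ with $X\in\mathbb{R}^{p\times p}$ skew-symmetric and having zero diagonal blocks (with respect to the block sizes $q_{j}-q_{j-1}$, $j=1,\dots,d+1$), and the metric is $\langle QX,QY\rangle=\tfrac12\mathrm{tr}(X^\top Y)$. For $\mathrm{Gr}(p,q)$, a tangent vector at $\mathrm{im}\,U$ (with $U\in\mathbb{R}^{p\times q}$, $U^\top U=I$) is represented by its horizontal lift $H\in\mathbb{R}^{p\times q}$ with $U^\top H=0$, and the metric is $\langle H_1,H_2\rangle=\mathrm{tr}(H_1^\top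 H_2)$. On each manifold, $\mathrm{grad}$ denotes the Riemannian gradient and $\mathrm{Exp}$ the Riemannian exponential map. **FRONT on $\mathrm{Flag}(p,q_{1:d})$.** The cost at time $t\ge T-1$ is $$f_{W_t}(\mathbf{U}_{1:d})=\Big\|W_t-\frac1d\sum_{i=1}^d\Pi_{\mathbf{U}_i}W_t\Big\|_F^2 .$$ Given an initial flag $\hat{\mathbf{U}}^{T-1}_{1:d}$, for $t=T-1,T,\dots$: set $\hat{\mathbf{U}}^{t,0}_{1:d}=\hat{\mathbf{U}}^{t}_{1:d}$; for $k=0,\dots,K-1$ set $$\hat{\mathbf{U}}^{t,k+1}_{1:d}=\mathrm{Exp}_{\hat{\mathbf{U}}^{t,k}_{1:d}}\big(-\alpha_t\,\mathrm{grad}\, f_{W_t}(\hat{\mathbf{U}}^{t,k}_{1:d})\big);$$ then set $\hat{\mathbf{U}}^{t+1}_{1:d}=\hat{\mathbf{U}}^{t,K}_{1:d}$. When $d=1$ the subscript $1:d$ is dropped. **GREAT on $\mathrm{Gr}(p,q)$.** The cost at time $t\ge T-1$ is $g_{W_t}(\mathbf{V})=\|W_t-\Pi_{\mathbf{V}}W_t\|_F^2$ for $\mathbf{V}\in\mathrm{Gr}(p,q)$. Given an initial point $\hat{\mathbf{V}}^{T-1}\in\mathrm{Gr}(p,q)$, for $t=T-1,T,\dots$: set $\hat{\mathbf{V}}^{t,0}=\hat{\mathbf{V}}^{t}$; for $k=0,\dots,K-1$ set $$\hat{\mathbf{V}}^{t,k+1}=\mathrm{Exp}_{\hat{\mathbf{V}}^{t,k}}\big(-\alpha_t\,\mathrm{grad}\,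 g_{W_t}(\hat{\mathbf{V}}^{t,k})\big);$$ then set $\hat{\mathbf{V}}^{t+1}=\hat{\mathbf{V}}^{t,K}$. **Equivalence of algorithms.** An algorithm on a Riemannian manifold $M$ is given by an update rule producing the next iterate from the current one (here, at time $t$, the map $\hat{\mathbf{U}}^{t}\mapsto\hat{\mathbf{U}}^{t+1}$). Two algorithms on $M$ are equivalent if equal initial points imply equal iterates at all later times. *)

(* Defs.v *)
From mathcomp Require Import all_boot all_order all_algebra.
From mathcomp Require Import all_classical all_reals all_analysis.

Set Implicit Arguments.
Unset Strict Implicit.
Unset Printing Implicit Defensive.

Import Order.TTheory GRing.Theory Num.Theory.
Import numFieldNormedType.Exports.

Local Open Scope ring_scope.
Local Open Scope classical_set_scope.

Fixpoint of_class_C (R : realType) (V W : normedModType R) (k : nat)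
    (A : set V) (F : V -> W) : Prop :=
  match k with
  | 0 => forall x, A x -> {for x, continuous F}
  | k'.+1 => (forall x, A x -> differentiable F x) /\
             (forall v : V, of_class_C k' A (fun x => 'D_v F x))
  end.

Definition smooth_near (R : realType) (V W : normedModType R)
    (x : V) (F : V -> W) : Prop :=
  exists A : set V, open_nbhs x A /\ forall k, of_class_C k A F.

(* A Riemannian manifold given as a quotient of a submanifold of a space of   *)
(* matrices: [rq_represents Q x] says that the matrix Q lies in the total     *)
(* space above the point x, [rq_horizontal Q] is the horizontal space at Q,   *)
(* and [rq_metric Q] is the inner product of the tangent vectors represented  *)
(* by two horizontal matrices at Q.                                           *)
Record riem_quotient (R : realType) := RiemQuotient {
  rq_point : choiceType;
  rq_rows : nat;
  rq_cols : nat;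
  rq_represents : 'M[R]_(rq_rows, rq_cols) -> rq_point -> Prop;
  rq_horizontal : 'M[R]_(rq_rows, rq_cols) -> set 'M[R]_(rq_rows, rq_cols);
  rq_metric : 'M[R]_(rq_rows, rq_cols) ->
    'M[R]_(rq_rows, rq_cols) -> 'M[R]_(rq_rows, rq_cols) -> R }.

Definition rq_matrix (R : realType) (M : riem_quotient R) : Type :=
  'M[R]_(rq_rows M, rq_cols M).

(* A tangent vector is encoded as the set of all its representatives          *)
(* (Q, H), with Q above the base point and H horizontal at Q.                 *)
Definition tangent (R : realType) (M : riem_quotient R) :=
  set (rq_matrix M * rq_matrix M).

Definition scale_tangent (R : realType) (M : riem_quotient R) (a : R)
    (v : tangent M) : tangent M :=
  [set (z.1, a *: z.2) | z in v].

(* A map into the quotient is smooth when it has smooth local lifts.          *)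
Definition smooth_lift_near (R : realType) (M : riem_quotient R)
    (V : normedModType R) (x : V) (phi : V -> rq_point M)
    (L : V -> rq_matrix M) : Prop :=
  smooth_near x L /\ \forall y \near x, rq_represents (L y) (phi y).

(* (Q, H) represents the velocity of c at t when some smooth lift of c passes *)
(* through Q at time t with the horizontal derivative H.                      *)
Definition velocity (R : realType) (M : riem_quotient R)
    (c : R -> rq_point M) (t : R) : tangent M :=
  [set z | rq_horizontal z.1 z.2 /\
    exists L : R -> rq_matrix M,
      [/\ smooth_lift_near t c L, L t = z.1 & derive1 L t = z.2]].

Definition tangent_metric (R : realType) (M : riem_quotient R)
    (v w : tangent M) : R :=
  xget 0 [set r | exists Q H1 H2,
    [/\ v (Q, H1), w (Q, H2) & r = rq_metric Q H1 H2]].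

(* The differential of f, tested on velocities of curves, is the inner        *)
(* product with the gradient.                                                 *)
Definition gradient (R : realType) (M : riem_quotient R)
    (f : rq_point M -> R) (x : rq_point M) : tangent M :=
  [set z | [/\ rq_represents z.1 x, rq_horizontal z.1 z.2 &
    forall (c : R -> rq_point M) (H : rq_matrix M),
      velocity c 0 (z.1, H) ->
      is_derive (0 : R) (1 : R) (fun s => f (c s)) (rq_metric z.1 z.2 H)]].

(* Near x, phi is the inverse of a chart: it is smooth at x and its           *)
(* differential at x is a bijection onto the tangent space at phi x.          *)
Definition local_parametrization (R : realType) (M : riem_quotient R) (n : nat)
    (phi : 'rV[R]_n -> rq_point M) (x : 'rV[R]_n) : Prop :=
  (exists L, smooth_lift_near x phi L) /\
  forall Q H, rq_represents Q (phi x) -> rq_horizontal Q H ->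
    exists! v : 'rV[R]_n, velocity (fun s : R => phi (x + s *: v)) 0 (Q, H).

Definition coord_vector (R : realType) (M : riem_quotient R) (n : nat)
    (phi : 'rV[R]_n -> rq_point M) (x : 'rV[R]_n) (i : 'I_n) : tangent M :=
  velocity (fun s : R => phi (x + s *: delta_mx 0 i)) 0.

Definition metric_coef (R : realType) (M : riem_quotient R) (n : nat)
    (phi : 'rV[R]_n -> rq_point M) (x : 'rV[R]_n) : 'M[R]_n :=
  \matrix_(i, j) tangent_metric (coord_vector phi x i) (coord_vector phi x j).

Definition christoffel (R : realType) (M : riem_quotient R) (n : nat)
    (phi : 'rV[R]_n -> rq_point M) (x : 'rV[R]_n) (k i j : 'I_n) : R :=
  let dg (l a b : 'I_n) : R :=
    'D_(delta_mx 0 l) (fun y => metric_coef phi y a b) x in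
  2^-1 * \sum_(l < n) invmx (metric_coef phi x) k l *
           (dg i j l + dg j i l - dg l i j).

(* Geodesics of the Levi-Civita connection, in local coordinates:             *)
(* u''_k + \sum_(i, j) Gamma^k_(i j)(u) u'_i u'_j = 0.                        *)
Definition geodesic (R : realType) (M : riem_quotient R)
    (c : R -> rq_point M) : Prop :=
  forall t : R, exists (n : nat) (phi : 'rV[R]_n -> rq_point M)
                       (u : R -> 'rV[R]_n),
    [/\ local_parametrization phi (u t), smooth_near t u,
        \forall s \near t, c s = phi (u s) &
        \forall s \near t, forall k : 'I_n,
          derive1n 2 u s 0 k + \sum_(i < n) \sum_(j < n)
            christoffel phi (u s) k i j *
            derive1 u s 0 i * derive1 u s 0 j = 0].

(* xget selects the unique such point; geodesics extend to all of R since     *)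
(* the manifolds below are compact.                                           *)
Definition riem_exp (R : realType) (M : riem_quotient R) (x : rq_point M)
    (v : tangent M) : rq_point M :=
  xget x [set y | exists c : R -> rq_point M,
    [/\ geodesic c, c 0 = x, velocity c 0 = v & y = c 1]].

Definition grad_step (R : realType) (M : riem_quotient R) (a : R)
    (f : rq_point M -> R) (x : rq_point M) : rq_point M :=
  riem_exp x (scale_tangent (- a) (gradient f x)).

Definition col_span (R : realType) (p n : nat) (Q : 'M[R]_(p, n)) (m : nat) :
    {vspace 'cV[R]_p} :=
  <<[seq col j Q | j : 'I_n <- enum 'I_n & (j < m)%N]>>%VS.

(* For a signature qs = [:: q_1; ...; q_d]. *)
Definition flag (R : realType) (p : nat) (qs : seq nat) :=
  {U : seq {vspace 'cV[R]_p} |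
    ([seq \dim V | V <- U] == qs) && sorted (fun V W => (V <= W)%VS) U}.

(* The set of the q-dimensional subspaces V of R^p, with V identified with    *)
(* the flag [:: V]: Gr(p, q) and Flag(p, (q)) are the same set. They get      *)
(* their own Riemannian structures below.                                     *)
Definition grassmannian (R : realType) (p q : nat) := flag R p [:: q].

Definition gr_subspace (R : realType) (p q : nat) (V : grassmannian R p q) :
    {vspace 'cV[R]_p} :=
  head 0%VS (val V).

(* Index j, from 0, of the diagonal block q_j <= i < q_(j+1) containing i.    *)
Definition flag_block (qs : seq nat) (i : nat) : nat :=
  count (fun m => (m <= i)%N) qs.

(* O(p) / (O(q_1) x O(q_2 - q_1) x ... x O(p - q_d)); a horizontal matrix at  *)
(* Q is Q *m X, and X = Q^T *m (Q *m X).                                      *)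
Definition flag_manifold (R : realType) (p : nat) (qs : seq nat) :
    riem_quotient R :=
  @RiemQuotient R (flag R p qs) p p
    (fun Q U => Q^T *m Q = 1%:M /\ val U = [seq col_span Q m | m <- qs])
    (fun Q H => exists X : 'M[R]_p,
       [/\ X^T = - X,
           forall i j : 'I_p, flag_block qs i = flag_block qs j -> X i j = 0 &
           H = Q *m X])
    (fun Q H1 H2 => 2^-1 * \tr ((Q^T *m H1)^T *m (Q^T *m H2))).

Definition gr_manifold (R : realType) (p q : nat) : riem_quotient R :=
  @RiemQuotient R (grassmannian R p q) p q
    (fun U V => U^T *m U = 1%:M /\ gr_subspace V = col_span U q)
    (fun U H => U^T *m H = 0)
    (fun U H1 H2 => \tr (H1^T *m H2)).

Definition orth_proj (R : realType) (p : nat) (V : {vspace 'cV[R]_p}) :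
    'M[R]_p :=
  xget 0 [set P : 'M[R]_p | forall x : 'cV[R]_p,
    (P *m x \in V) /\ (forall y, y \in V -> (x - P *m x)^T *m y = 0)].

Definition frobenius (R : realType) (m n : nat) (A : 'M[R]_(m, n)) : R :=
  Num.sqrt (\sum_i \sum_j A i j ^+ 2).

(* [w_(t-T+1) ... w_t], for t >= T - 1. *)
Definition window (R : realType) (p T : nat) (w : nat -> 'cV[R]_p) (t : nat) :
    'M[R]_(p, T) :=
  \matrix_(i < p, j < T) w (t.+1 - T + j)%N i 0.

Definition front_cost (R : realType) (p T : nat) (qs : seq nat)
    (W : 'M[R]_(p, T)) (U : flag R p qs) : R :=
  frobenius (W - (size qs)%:R^-1 *: \sum_(V <- val U) orth_proj V *m W) ^+ 2.

Definition great_cost (R : realType) (p T q : nat) (W : 'M[R]_(p, T))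
    (V : grassmannian R p q) : R :=
  frobenius (W - orth_proj (gr_subspace V) *m W) ^+ 2.

Definition front (R : realType) (p : nat) (qs : seq nat) (T K : nat)
    (w : nat -> 'cV[R]_p) (alpha : nat -> R) (t : nat) :
    flag R p qs -> flag R p qs :=
  iter K (@grad_step R (flag_manifold R p qs) (alpha t)
            (@front_cost R p T qs (window T w t))).

Definition great (R : realType) (p q T K : nat)
    (w : nat -> 'cV[R]_p) (alpha : nat -> R) (t : nat) :
    grassmannian R p q -> grassmannian R p q :=
  iter K (@grad_step R (gr_manifold R p q) (alpha t)
            (@great_cost R p T q (window T w t))).

(* x is a sequence of iterates, from time t0 on, of the algorithm whose       *)
(* update rule at time t is A t.                                              *)
Definition iterates (M : Type) (t0 : nat) (A : nat -> M -> M) (x : nat -> M) :=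
  forall t, (t0 <= t)%N -> x t.+1 = A t (x t).

Definition equivalent_algorithms (M : Type) (t0 : nat)
    (A1 A2 : nat -> M -> M) : Prop :=
  forall x y : nat -> M,
    iterates t0 A1 x -> iterates t0 A2 y -> x t0 = y t0 ->
    forall t, (t0 < t)%N -> x t = y t.

(* Main.v *)
From HB Require Import structures.
Require Import Defs.
From mathcomp Require Import all_boot all_order all_algebra.
From mathcomp Require Import zify.
From mathcomp Require Import all_classical all_reals all_analysis.
Import Order.TTheory GRing.Theory Num.Theory.
Import numFieldNormedType.Exports.
Local Open Scope classical_set_scope.
Local Open Scope ring_scope.

(** For d = 1 the cost of FRONT averages over the single projector of the
    subspace, so it is the cost of GREAT ([front_cost1]), and the point sets of
    the two manifolds coincide. It remains to see that the two quotient
    presentations, O(p) / (O(q) x O(p - q)) and the Stiefel manifold modulo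
    O(q), carry the same Riemannian geometry. No geodesic is computed: both
    gradient steps are chosen from sets of endpoints of geodesics, and these
    sets are shown to be equal.

    Let J be the inclusion of R^q in R^p as the first q coordinates
    ([pid_mx q]). An orthogonal matrix Q lies above the subspace V in the first
    presentation exactly when its frame Q J lies above V in the second
    ([flag_representsP]). On horizontal matrices, Z goes to Z J. Since Z = Q X
    with X skew and zero on both diagonal blocks, Z is determined by its first
    q columns: with U = Q J and H = Z J, it is (H U^T - U H^T) Q, called
    [flag_extension Q H] below. The factor 1/2 in the metric of the flag
    manifold compensates for the two copies of the off-diagonal block of X, so
    Z |-> Z J is an isometry of horizontal spaces ([horizontal_metric]).

    Velocities are defined through smooth local lifts, and this is the
    analytic core of the proof. A lift Q(s) to O(p) gives the lift Q(s) J to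
    frames. Conversely, a smooth lift l(s) to frames has to be completed to
    orthogonal matrices, smoothly and with the horizontal derivative at the
    base time ([smooth_frame_lift]). With U = l(0), the matrix
    G(s) = (l + U) (1 + l^T U)^-1 (l + U)^T - 1 is orthogonal, maps U to l(s),
    and is rational in the entries of l(s); it plays the part of the
    Householder reflection that exchanges two unit vectors. Then
    G(s) G(0) Q is a lift through Q, and its derivative at 0 is exactly
    [flag_extension Q (l'(0))] when l'(0) is horizontal.

    Call tangent vectors [corresponding] when their representatives are
    exchanged by (Q, Z) |-> (Q J, Z J). Velocities of the same curve and
    gradients of the same function correspond, and equality of tangent vectors,
    inner products and scaling agree on corresponding ones. Hence the two
    structures have the same local parametrizations, metric coefficients,
    Christoffel symbols, geodesics and exponential map, and so the same
    gradient step ([grad_step_flagE]); equality of the iterates follows by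
    induction on time. *)

Set Implicit Arguments.
Unset Strict Implicit.
Unset Printing Implicit Defensive.

(** * Functions of class C^k *)

Section ClassC.
Context {R : realType} {V : normedModType R}.
Implicit Types (W : normedModType R) (A : set V) (k : nat).

Lemma near_eq_differentiable W (F G : V -> W) (x : V) :
  (\forall y \near x, F y = G y) -> differentiable F x -> differentiable G x.
Proof.
move=> FG dF; have Fx : F x = G x := nbhs_singleton FG.
have dFc := diff_continuous dF.
have GE : G \o shift x = cst (G x) + 'd F x +o_ 0 id.
  apply/eqaddoP => e e0; have /eqaddoP/(_ _ e0) := diff_locally dF.
  have : \forall h \near 0, F (h + x) = G (h + x).
    by move: FG; rewrite (near_shift 0)/= subr0.
  by apply: filterS2 => h /= FGh; rewrite !fctE /= FGh Fx.
by apply/diff_locallyP; rewrite (diff_unique dFc GE).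
Qed.

Lemma of_class_C_sub W k A B (F : V -> W) : B `<=` A ->
  of_class_C k A F -> of_class_C k B F.
Proof.
elim: k F => [|k IH] F BA /= CF; first by move=> x /BA; exact: CF.
by case: CF => dF CF; split=> [x /BA|v]; [exact: dF | exact: IH].
Qed.

(** Derivatives are known by formulas valid only on the open set A, and the
    definition of class C^k recurses on the derivative as a function, so the
    induction steps below need this locality. *)
Lemma of_class_C_ext W k A (F G : V -> W) : open A ->
  (forall x, A x -> F x = G x) -> of_class_C k A F -> of_class_C k A G.
Proof.
move=> oA; elim: k F G => [|k IH] F G FG /= CF.
  move=> x Ax; have nA : nbhs x A by exact: open_nbhs_nbhs.
  have CFx : F y @[y --> x] --> F x := CF x Ax.
  suff : G y @[y --> x] --> G x by [].
  rewrite -FG //; apply: cvg_trans CFx; apply: near_eq_cvg.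
  by near=> y; apply: FG; near: y.
have nFG x : A x -> \forall y \near x, F y = G y.
  move=> Ax; have nA : nbhs x A by exact: open_nbhs_nbhs.
  by near=> y; apply: FG; near: y.
case: CF => dF CF; split=> [x Ax|v].
  exact: near_eq_differentiable (nFG x Ax) (dF x Ax).
by apply: IH (CF v) => x Ax; exact: near_eq_derive (nFG x Ax).
Unshelve. all: by end_near. Qed.

Lemma of_class_CW W k A (F : V -> W) : of_class_C k.+1 A F -> of_class_C k A F.
Proof.
elim: k F => [|k IH] F [dF CF].
  by move=> x /dF; exact: differentiable_continuous.
by split=> // v; apply: IH; exact: CF.
Qed.

Lemma of_class_C_cst W k A (w : W) : of_class_C k A (fun=> w).
Proof.
elim: k w => [|k IH] w /=; first by move=> x _; exact: cst_continuous.
split=> [x _|v]; first exact: differentiable_cst.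
have -> : (fun x : V => 'D_v (fun=> w) x) = fun=> 0.
  by apply/funext => x; exact: derive_cst.
exact: IH.
Qed.

Lemma of_class_CD W k A (F G : V -> W) : open A ->
  of_class_C k A F -> of_class_C k A G ->
  of_class_C k A (fun x => F x + G x).
Proof.
move=> oA; elim: k F G => [|k IH] F G /=.
  by move=> CF CG x Ax; apply: cvgD; [exact: CF | exact: CG].
move=> [dF CF] [dG CG]; split=> [x Ax|v].
  by apply: differentiableD; [exact: dF | exact: dG].
apply: of_class_C_ext (IH _ _ (CF v) (CG v)) => // x Ax.
by rewrite -deriveD //; apply/diff_derivable; [exact: dF | exact: dG].
Qed.

Lemma of_class_C_linear (W W' : normedModType R) k A (F : V -> W)
    (f : {linear W -> W'}) : open A -> continuous f ->
  of_class_C k A F -> of_class_C k A (f \o F).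
Proof.
move=> oA fc; elim: k F => [|k IH] F /=.
  by move=> CF x Ax; apply: continuous_comp; [exact: CF | exact: fc].
move=> [dF CF]; have df y : differentiable f y by exact: linear_differentiable.
split=> [x Ax|v]; first by apply: differentiable_comp => //; exact: dF.
apply: of_class_C_ext (IH _ (CF v)) => // x Ax /=.
have dFx := dF _ Ax.
have dfF : differentiable (f \o F) x := differentiable_comp dFx (df _).
by rewrite (deriveE v dfF) (deriveE v dFx) (diff_comp dFx (df _)) /= diff_lin.
Qed.

Lemma of_class_C_sum W (I : Type) (r : seq I) (P : pred I) k A
    (F : I -> V -> W) : open A -> (forall i, of_class_C k A (F i)) ->
  of_class_C k A (fun x => \sum_(i <- r | P i) F i x).
Proof.
move=> oA CF; elim: r => [|i r IH].
  by rewrite (_ : (fun _ => _) = fun=> 0); [exact: of_class_C_cst |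
     apply/funext => x; rewrite big_nil].
rewrite (_ : (fun _ => _) = fun x => (if P i then F i x else 0) +
   \sum_(i <- r | P i) F i x); last first.
  by apply/funext => x; rewrite big_cons; case: ifP => // _; rewrite add0r.
apply: of_class_CD => //; case: (P i); [exact: CF | exact: of_class_C_cst].
Qed.

Lemma of_class_CM k A (f g : V -> R) : open A ->
  of_class_C k A f -> of_class_C k A g ->
  of_class_C k A (fun x => f x * g x).
Proof.
move=> oA; elim: k f g => [|k IH] f g.
  by move=> Cf Cg x Ax; apply: cvgM; [exact: Cf | exact: Cg].
move=> Cf Cg; have Cf' := of_class_CW Cf; have Cg' := of_class_CW Cg.
case: Cf => df Cf; case: Cg => dg Cg; split=> [x Ax|v].
  by apply: differentiableM; [exact: df | exact: dg].
apply: (of_class_C_ext _ _ (of_class_CD _ (IH _ _ Cf' (Cg v))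
   (IH _ _ Cg' (Cf v)))) => // x Ax.
by rewrite deriveM //; apply: diff_derivable; [exact: df | exact: dg].
Qed.

(** The derivative of 1/f is -f'(1/f)^2, which contains 1/f only at a lower
    order of regularity. *)
Lemma of_class_CV k A (f : V -> R) : open A -> (forall x, A x -> f x != 0) ->
  of_class_C k A f -> of_class_C k A (fun x => (f x)^-1).
Proof.
move=> oA f0; elim: k => [|k IH].
  by move=> Cf x Ax; apply: cvgV; [exact: f0 | exact: Cf].
move=> Cf; have Cf' := IH (of_class_CW Cf).
case: Cf => df Cf; split=> [x Ax|v].
  by apply: differentiableV; [exact: df | exact: f0].
apply: (of_class_C_ext _ _ (of_class_CM _ (of_class_C_cst k A (-1 : R))
  (of_class_CM _ (of_class_CM _ Cf' Cf') (Cf v)))) => // x Ax.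
rewrite deriveV //; [|exact: f0|exact/diff_derivable/df].
by rewrite -exprVn expr2 mulN1r [RHS]mulNr.
Qed.

Lemma of_class_C_prod (I : Type) (r : seq I) (P : pred I) k A
    (F : I -> V -> R) : open A -> (forall i, of_class_C k A (F i)) ->
  of_class_C k A (fun x => \prod_(i <- r | P i) F i x).
Proof.
move=> oA CF; elim: r => [|i r IH].
  by rewrite (_ : (fun _ => _) = fun=> 1); [exact: of_class_C_cst |
     apply/funext => x; rewrite big_nil].
rewrite (_ : (fun _ => _) = fun x => (if P i then F i x else 1) *
   \prod_(i <- r | P i) F i x); last first.
  by apply/funext => x; rewrite big_cons; case: ifP => // _; rewrite mul1r.
apply: of_class_CM => //; case: (P i); [exact: CF | exact: of_class_C_cst].
Qed.

Lemma of_class_C_mxP m n k A (F : V -> 'M[R]_(m, n)) : open A ->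
  of_class_C k A F <-> forall i j, of_class_C k A (fun x => F x i j).
Proof.
move=> oA; split=> [CF i j|CF].
  have lf : linear (fun M : 'M[R]_(m, n) => M i j : R).
    by move=> a B C; rewrite !mxE.
  pose Lf := GRing.isLinear.Build _ _ _ _ _ lf.
  pose f : {linear 'M[R]_(m, n) -> R} :=
    HB.pack (fun M : 'M[R]_(m, n) => M i j : R) Lf.
  by apply: (of_class_C_linear (f := f)) => //; exact: coord_continuous.
rewrite (_ : F = fun x => \sum_i \sum_j F x i j *: delta_mx i j); last first.
  by apply/funext => x; exact: matrix_sum_delta.
apply: of_class_C_sum => // i; apply: of_class_C_sum => // j.
have lf : linear (fun a : R => a *: delta_mx i j : 'M[R]_(m, n)).
  by move=> a b c; rewrite scalerDl scalerA.
pose Lf := GRing.isLinear.Build _ _ _ _ _ lf.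
pose f : {linear R -> 'M[R]_(m, n)} :=
  HB.pack (fun a : R => a *: delta_mx i j : 'M[R]_(m, n)) Lf.
apply: (of_class_C_linear (f := f)) => // a.
by apply: cvgZr_tmp; exact: cvg_id.
Qed.

Lemma of_class_C_mulmx m n r k A
    (F : V -> 'M[R]_(m, n)) (G : V -> 'M[R]_(n, r)) :
  open A -> of_class_C k A F -> of_class_C k A G ->
  of_class_C k A (fun x => F x *m G x).
Proof.
move=> oA /(of_class_C_mxP _ _ oA) CF /(of_class_C_mxP _ _ oA) CG.
apply/(of_class_C_mxP _ _ oA) => i j.
rewrite (_ : (fun _ => _) = fun x => \sum_l F x i l * G x l j); last first.
  by apply/funext => x; rewrite mxE.
by apply: of_class_C_sum => // l; exact: of_class_CM.
Qed.

Lemma of_class_C_tr m n k A (F : V -> 'M[R]_(m, n)) :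
  open A -> of_class_C k A F -> of_class_C k A (fun x => (F x)^T).
Proof.
move=> oA /(of_class_C_mxP _ _ oA) CF; apply/(of_class_C_mxP _ _ oA) => i j.
rewrite (_ : (fun _ => _) = fun x => F x j i) //.
by apply/funext => x; rewrite mxE.
Qed.

Lemma of_class_C_det n k A (F : V -> 'M[R]_n) :
  open A -> of_class_C k A F -> of_class_C k A (fun x => \det (F x)).
Proof.
move=> oA /(of_class_C_mxP _ _ oA) CF; apply: of_class_C_sum => // s.
apply: of_class_CM => //; first exact: of_class_C_cst.
exact: of_class_C_prod.
Qed.

(** Cramer's formula expresses the entries of the inverse rationally. *)
Lemma of_class_C_invmx n k A (F : V -> 'M[R]_n) :
  open A -> (forall x, A x -> F x \in unitmx) ->
  of_class_C k A F -> of_class_C k A (fun x => invmx (F x)).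
Proof.
move=> oA uF CF.
apply: (of_class_C_ext (F := fun x => (\det (F x))^-1 *: \adj (F x))) => //.
  by move=> x Ax; rewrite /invmx uF.
apply/(of_class_C_mxP _ _ oA) => i j.
rewrite (_ : (fun _ => _) = fun x => (\det (F x))^-1 *
   ((-1) ^+ (j + i) * \det (row' j (col' i (F x))))); last first.
  by apply/funext => x; rewrite !mxE.
apply: of_class_CM => //.
  apply: of_class_CV => //; last exact: of_class_C_det.
  by move=> x /uF; rewrite unitmxE unitfE.
apply: of_class_CM => //; first exact: of_class_C_cst.
apply: of_class_C_det => //; apply/(of_class_C_mxP _ _ oA) => a b.
rewrite (_ : (fun _ => _) = fun x => F x (lift j a) (lift i b)); last first.
  by apply/funext => x; rewrite !mxE.
by move/(of_class_C_mxP _ _ oA): CF; exact.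
Qed.

Lemma near_unitmx n (A : set V) (F : V -> 'M[R]_n) x :
  open_nbhs x A -> of_class_C 0 A F -> F x \in unitmx ->
  exists2 B, open_nbhs x B & B `<=` A `&` [set y | F y \in unitmx].
Proof.
move=> [oA Ax] CF Fx.
have cF : \det (F y) @[y --> x] --> \det (F x).
  by have /(_ x Ax) := of_class_C_det oA CF.
have nA : nbhs x A by exact: open_nbhs_nbhs.
have : nbhs x (A `&` [set y | F y \in unitmx]).
  apply: filterI => //=.
  have : \forall y \near x, \det (F y) != 0.
    by apply: (cvgr_neq0 _ cF); rewrite -unitfE -unitmxE.
  by apply: filterS => y; rewrite /= unitmxE unitfE.
by rewrite nbhsE => -[B oB BA]; exists B.
Qed.

Lemma smooth_near_differentiable W (F : V -> W) x :
  smooth_near x F -> differentiable F x.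
Proof. by move=> [A [[_ Ax] /(_ 1%N)[dF _]]]; exact: dF. Qed.

End ClassC.

Section MatrixDerive.
Context {R : realType} {V : normedModType R}.

Lemma is_derive_mxP m n (F : V -> 'M[R]_(m, n)) dF x v :
  is_derive x v F dF <->
  forall i j, is_derive x v (fun y => F y i j) (dF i j).
Proof.
split=> [[dvF <-] i j|dvF].
  rewrite derive_mx // mxE; apply: derivableP.
  by move/derivable_mxP: dvF.
have dvF' : derivable F x v by apply/derivable_mxP => i j; case: (dvF i j).
split=> //; rewrite derive_mx //; apply/matrixP => i j; rewrite mxE.
by case: (dvF i j).
Qed.

Lemma is_derive_mulmx m n r (F : V -> 'M[R]_(m, n)) (G : V -> 'M[R]_(n, r))
    dF dG x v :
  is_derive x v F dF -> is_derive x v G dG ->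
  is_derive x v (fun y => F y *m G y) (dF *m G x + F x *m dG).
Proof.
move=> /is_derive_mxP dvF /is_derive_mxP dvG; apply/is_derive_mxP => i j.
have := is_derive_sum (fun l => is_deriveM (dvF i l) (dvG l j)).
rewrite (_ : \sum_l _ = (fun y => (F y *m G y) i j)); last first.
  by apply/funext => y; rewrite fct_sumE mxE.
move/is_derive_eq; apply; rewrite !mxE -big_split /=.
by apply: eq_bigr => l _; rewrite addrC; congr (_ + _); exact: mulrC.
Qed.

Lemma is_derive_tr m n (F : V -> 'M[R]_(m, n)) dF x v :
  is_derive x v F dF -> is_derive x v (fun y => (F y)^T) dF^T.
Proof.
move=> /is_derive_mxP dvF; apply/is_derive_mxP => i j; rewrite mxE.
by rewrite (_ : (fun _ => _) = fun y => F y j i) //;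
   apply/funext => y; rewrite mxE.
Qed.

Lemma is_derive1 (W : normedModType R) (f : R -> W) t :
  differentiable f t -> is_derive t 1 f (derive1 f t).
Proof. by move=> df; rewrite derive1E; apply/derivableP/diff_derivable. Qed.

End MatrixDerive.

(** * Orthonormal frames *)

Section Orthonormal.
Context {R : rcfType}.

Lemma unit_vector_orthogonal p q (U : 'M[R]_(p, q)) : (q < p)%N ->
  exists v : 'cV[R]_p, v^T *m U = 0 /\ v^T *m v = 1%:M.
Proof.
move=> qp; pose r := nz_row (kermx U).
have r0 : r != 0.
  rewrite nz_row_eq0 -mxrank_eq0 mxrank_ker subn_eq0 -ltnNge.
  exact: leq_ltn_trans (rank_leq_col _) qp.
have rU : r *m U = 0 by apply: sub_kermxP; exact: nz_row_sub.
pose a := \sum_j r 0 j ^+ 2.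
have rrT : r *m r^T = a%:M.
  by apply/matrixP => i j; rewrite !ord1 !mxE eqxx; apply: eq_bigr => l _;
     rewrite mxE expr2.
have a0 : 0 < a.
  rewrite lt_def sumr_ge0 ?andbT; last by move=> j _; exact: sqr_ge0.
  apply: contra_neq r0; move/psumr_eq0P => r0; apply/rowP => j; rewrite mxE.
  by apply/eqP; rewrite -sqrf_eq0 r0 // => l _; exact: sqr_ge0.
exists ((Num.sqrt a)^-1 *: r^T); rewrite linearZ /= trmxK; split.
  by rewrite -scalemxAl rU scaler0.
rewrite -scalemxAl -scalemxAr rrT scalerA -invfM -expr2 sqr_sqrtr ?ltW //.
by rewrite scale_scalar_mx mulVf // gt_eqF.
Qed.

(** Induction on p - q: while q < p, some unit vector is orthogonal to the
    columns and extends the family by one. *)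
Lemma orthonormal_completion p q (U : 'M[R]_(p, q)) :
  (q <= p)%N -> U^T *m U = 1%:M ->
  exists Q : 'M[R]_p, Q^T *m Q = 1%:M /\ Q *m pid_mx q = U.
Proof.
move=> /subnKC; move: (p - q)%N => d; elim: d q U => [|d IH] q U.
  by rewrite addn0 => qp; subst q => UU; exists U; rewrite pid_mx_1 mulmx1.
move=> qdp UU; have qp : (q < p)%N by rewrite -qdp -addSnnS leq_addr.
have [v [vU vv]] := unit_vector_orthogonal U qp.
have [||Q [QQ QJ]] := IH (q + 1)%N (row_mx U v).
- by rewrite -addnA add1n.
- rewrite tr_row_mx mul_col_row UU vU vv -[U^T *m v]trmxK trmx_mul trmxK vU.
  by rewrite trmx0 scalar_mx_block.
exists Q; split=> //.
have UJ : row_mx U v *m pid_mx q = U.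
  by rewrite pid_mx_col mul_row_col mulmx1 mulmx0 addr0.
rewrite -[RHS]UJ -QJ -mulmxA mul_pid_mx; congr (_ *m pid_mx _).
by lia.
Qed.

End Orthonormal.

Section FrameReflection.
Context {R : fieldType} {p q : nat}.
Implicit Types U l : 'M[R]_(p, q).

(** For q = 1 and unit vectors U and l this is x |-> 2 <x, u> u - x, with u the
    unit vector in the direction of l + U; it exchanges U and l. For orthonormal
    frames, the middle factor is the inverse of (l + U)^T U, so that U is still
    sent to l; it need not be symmetric. *)
Definition frame_reflection U l : 'M[R]_p :=
  (l + U) *m invmx (1%:M + l^T *m U) *m (l + U)^T - 1%:M.

(** With S = l + U and M = 1 + l^T U, orthonormality of both frames gives
    S^T S = M + M^T, and then (S M^-1 S^T - 1)^T (S M^-1 S^T - 1) telescopes. *)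
Lemma frame_reflection_orthogonal U l :
  U^T *m U = 1%:M -> l^T *m l = 1%:M -> 1%:M + l^T *m U \in unitmx ->
  (frame_reflection U l)^T *m frame_reflection U l = 1%:M.
Proof.
rewrite /frame_reflection => UU ll.
set M := 1%:M + _ => uM; set S := l + U.
have SS : S^T *m S = M + M^T.
  rewrite /S /M [(l + U)^T]linearD [(1%:M + _)^T]linearD /=.
  rewrite trmx1 trmx_mul trmxK mulmxDl !mulmxDr UU ll.
  by rewrite [U^T *m l + _]addrC addrACA.
clearbody S; rewrite [(_ - 1%:M)^T]linearB /= trmx1 !trmx_mul trmxK.
rewrite mulmxBl mul1mx mulmxBr mulmx1.
set N := invmx M; rewrite !mulmxA -[_ *m S^T *m S]mulmxA SS mulmxDr.
have -> : S *m N^T *m M^T = S.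
  by rewrite -mulmxA -trmx_mul mulmxV // trmx1 mulmx1.
have MN : M *m N = 1%:M by exact: mulmxV.
rewrite !mulmxDl -[_ *m M *m N]mulmxA MN mulmx1.
by rewrite [X in X - _ - _]addrC addrK opprB addrC subrK.
Qed.

Lemma frame_reflection_frame U l :
  U^T *m U = 1%:M -> 1%:M + l^T *m U \in unitmx ->
  frame_reflection U l *m U = l.
Proof.
move=> UU uM; rewrite /frame_reflection mulmxBl mul1mx.
have SU : (l + U)^T *m U = 1%:M + l^T *m U.
  by rewrite [(l + U)^T]linearD /= mulmxDl UU addrC.
by rewrite -[_ *m (l + U)^T *m U]mulmxA SU mulmxKV // addrK.
Qed.

End FrameReflection.

(** * Horizontal matrices on the flag manifold *)

Section Horizontal.
Context {R : realType} {p q : nat}.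
Hypothesis qp : (q <= p)%N.
Local Notation J := (pid_mx q : 'M[R]_(p, q)).
Local Notation P := (pid_mx q : 'M[R]_p).
Implicit Types (Q X Z : 'M[R]_p) (H : 'M[R]_(p, q)).

Lemma pid_mx_tr_mul : J^T *m J = 1%:M.
Proof. by rewrite tr_pid_mx mul_pid_mx !(minnn, minn_idPr qp) pid_mx_1. Qed.

Lemma pid_mx_mul_tr : J *m J^T = P.
Proof. by rewrite tr_pid_mx mul_pid_mx !minnn. Qed.

(** With P the projector on the first q coordinates, X P + P X doubles the top
    left block, kills the bottom right block and keeps the two others, so this
    equation says that both diagonal blocks of X vanish. *)
Definition off_diagonal X := X = X *m P + P *m X.

Lemma off_diagonalP X : off_diagonal X <->
  forall i j : 'I_p, flag_block [:: q] i = flag_block [:: q] j -> X i j = 0.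
Proof.
have XPE i j : (X *m P + P *m X) i j = X i j *+ ((i < q) + (j < q)).
  rewrite !mxE (bigD1 j) //= [in X in _ + X](bigD1 i) //= !big1 => [|l|l].
  - by rewrite !mxE !eqxx /= !addr0 mulr_natr mulr_natl addrC mulrnDr.
  - by rewrite !mxE eq_sym => /negPf; rewrite eqE /= => ->; rewrite mul0r.
  - by rewrite !mxE => /negPf; rewrite eqE /= => ->; rewrite mulr0.
have blockE i : flag_block [:: q] i = ~~ (i < q)%N.
  by rewrite /flag_block /= addn0 -leqNgt.
split=> [XP i j|X0].
  rewrite !blockE => bij; have := XPE i j; rewrite -XP.
  have -> : (i < q)%N = (j < q)%N by move: bij; do 2!case: (_ < _)%N.
  case: (j < q)%N => //; rewrite mulr2n => /eqP.
  by rewrite -subr_eq0 opprD addNKr oppr_eq0 => /eqP.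
apply/matrixP => i j; rewrite XPE.
have := X0 i j; rewrite !blockE.
by case: (i < q)%N; case: (j < q)%N => // ->; rewrite ?mul0rn.
Qed.

(** For Q orthogonal and H horizontal at U = Q J, this is the horizontal matrix
    at Q with first q columns H: the infinitesimal rotation H U^T - U H^T moves
    the frame U with velocity H and acts here on all the columns of Q. *)
Definition flag_extension Q H :=
  (H *m (Q *m J)^T - Q *m J *m H^T) *m Q.

Lemma flag_extension_skew Q H : Q^T *m Q = 1%:M -> (Q *m J)^T *m H = 0 ->
  exists X, [/\ X^T = - X, off_diagonal X & flag_extension Q H = Q *m X].
Proof.
move=> QQ UH; have QQT : Q *m Q^T = 1%:M by exact: mulmx1C.
have HU : H^T *m (Q *m J) = 0 by rewrite -[LHS]trmxK trmx_mul trmxK UH trmx0.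
exists (Q^T *m H *m J^T - J *m H^T *m Q); split.
- rewrite linearB /= !trmx_mul !trmxK opprB !mulmxA //.
- have JJ r (A : 'M[R]_(q, r)) : J^T *m (J *m A) = A.
    by rewrite mulmxA pid_mx_tr_mul mul1mx.
  have HQJ r (A : 'M[R]_(q, r)) : H^T *m (Q *m (J *m A)) = 0.
    by rewrite [Q *m _]mulmxA mulmxA HU mul0mx.
  have JQH r (A : 'M[R]_(q, r)) : J^T *m (Q^T *m (H *m A)) = 0.
    by rewrite !mulmxA -trmx_mul UH mul0mx.
  rewrite /off_diagonal mulmxBl mulmxBr -pid_mx_mul_tr -!mulmxA.
  by rewrite !JJ HQJ JQH !mulmx0 subr0 sub0r.
- by rewrite /flag_extension mulmxBr mulmxBl trmx_mul !mulmxA QQT mul1mx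
     -[H *m J^T *m Q^T *m Q]mulmxA QQ mulmx1.
Qed.

Lemma flag_extension_frame Q H :
  Q^T *m Q = 1%:M -> (Q *m J)^T *m H = 0 -> flag_extension Q H *m J = H.
Proof.
move=> QQ UH; have HU : H^T *m (Q *m J) = 0.
  by rewrite -[LHS]trmxK trmx_mul trmxK UH trmx0.
rewrite /flag_extension -mulmxA mulmxBl -!mulmxA HU !mulmx0 subr0.
rewrite trmx_mul -!mulmxA [Q^T *m _]mulmxA QQ mul1mx pid_mx_tr_mul.
by rewrite mulmx1.
Qed.

Lemma off_diagonal_corner X : off_diagonal X -> J^T *m X *m J = 0.
Proof.
move=> XP; have : J^T *m X *m J = J^T *m X *m J + J^T *m X *m J.
  rewrite {1}XP -pid_mx_mul_tr mulmxDr mulmxDl !mulmxA pid_mx_tr_mul mul1mx.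
  by congr (_ + _); rewrite -mulmxA pid_mx_tr_mul mulmx1.
by move/eqP; rewrite -subr_eq0 opprD addNKr oppr_eq0 => /eqP.
Qed.

Lemma horizontal_extension Q X : Q^T *m Q = 1%:M ->
  X^T = - X -> off_diagonal X -> flag_extension Q (Q *m X *m J) = Q *m X.
Proof.
move=> QQ XT XP; rewrite /flag_extension !trmx_mul XT mulmxBl.
rewrite -!mulmxA QQ mulmx1.
rewrite [J *m (J^T *m _)]mulmxA !pid_mx_mul_tr mulNmx !mulmxN opprK.
by rewrite mulmx1 -mulmxDr -XP.
Qed.

(** The two off-diagonal blocks of a skew matrix are opposite transposes of each
    other, so they contribute equally to the trace; the first q columns carry
    one of the two contributions. *)
Lemma horizontal_metric Q X1 X2 : Q^T *m Q = 1%:M ->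
  X1^T = - X1 -> X2^T = - X2 -> off_diagonal X2 ->
  2^-1 * \tr ((Q^T *m (Q *m X1))^T *m (Q^T *m (Q *m X2))) =
  \tr ((Q *m X1 *m J)^T *m (Q *m X2 *m J)).
Proof.
move=> QQ X1T X2T X2P.
rewrite ![Q^T *m (Q *m _)]mulmxA QQ !mul1mx.
have -> : \tr ((Q *m X1 *m J)^T *m (Q *m X2 *m J)) = \tr (X1^T *m X2 *m P).
  rewrite !trmx_mul -!mulmxA [Q^T *m _]mulmxA QQ mul1mx mxtrace_mulC.
  by rewrite -!mulmxA pid_mx_mul_tr.
have -> : \tr (X1^T *m X2) = \tr (X1^T *m X2 *m P) *+ 2.
  have E : X1^T *m X2 = X1^T *m X2 *m P + X1^T *m P *m X2.
    by rewrite {1}X2P mulmxDr !mulmxA.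
  rewrite {1}E linearD /= mulr2n; congr (_ + _).
  rewrite mxtrace_mulC -mxtrace_tr !trmx_mul trmxK tr_pid_mx X2T X1T.
  have trN (A : 'M[R]_p) : \tr (- A) = - \tr A by exact: raddfN.
  by rewrite mulmxN !mulNmx !trN -mulmxA mxtrace_mulC mulmxA mxtrace_mulC.
by rewrite -[X in _ * X]mulr_natl mulKf // pnatr_eq0.
Qed.

End Horizontal.

(** * Smooth completion of moving frames *)

Section FrameLift.
Context {R : realType} {p q : nat}.
Local Notation J := (pid_mx q : 'M[R]_(p, q)).

Lemma add_scalar_mx1 n : 1%:M + 1%:M = 2%:M :> 'M[R]_n.
Proof. by rewrite -raddfD. Qed.

Lemma frame_reflection_self (U : 'M[R]_(p, q)) : U^T *m U = 1%:M ->
  frame_reflection U U = 2 *: (U *m U^T) - 1%:M.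
Proof.
move=> UU; have UU2 : U + U = 2 *: U by rewrite scaler_nat mulr2n.
have M2 := add_scalar_mx1 q.
rewrite /frame_reflection UU UU2 M2 invmx_scalar mul_mx_scalar scalerA.
by rewrite mulVf ?pnatr_eq0 // scale1r linearZ /= -scalemxAr.
Qed.

(** At x the middle factor N = (1 + l^T U)^-1 of the reflection is 1/2, and its
    derivative is zero: N M = 1 with M = 1 + l^T U, and M has derivative
    H^T U = 0. Only the two outer factors contribute. *)
Lemma is_derive_frame_reflection (V : normedModType R) (l : V -> 'M[R]_(p, q))
    (U H : 'M[R]_(p, q)) x v :
  l x = U -> U^T *m U = 1%:M -> U^T *m H = 0 ->
  (\forall y \near x, 1%:M + (l y)^T *m U \in unitmx) ->
  derivable (fun y => invmx (1%:M + (l y)^T *m U)) x v ->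
  is_derive x v l H ->
  is_derive x v (fun y => frame_reflection U (l y)) (H *m U^T + U *m H^T).
Proof.
move=> lx UU UH uM dN dl.
have HU : H^T *m U = 0 by rewrite -[LHS]trmxK trmx_mul trmxK UH trmx0.
have M2 := add_scalar_mx1 q.
pose M y := 1%:M + (l y)^T *m U; pose N y := invmx (M y).
have Mx : M x = 2%:M by rewrite /M lx UU M2.
have dM : is_derive x v M 0.
  have := is_deriveD (is_derive_cst (1%:M : 'M[R]_q) x v)
    (is_derive_mulmx (is_derive_tr dl) (is_derive_cst U x v)).
  by move/is_derive_eq; apply; rewrite HU mulmx0 !addr0.
(* Differentiate N M = 1, where N is differentiable by [dN]. *)
have dN0 : is_derive x v N 0.
  have dN' : is_derive x v N ('D_v N x) by exact: derivableP.
  suff <- : 'D_v N x = 0 by [].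
  have d1 : is_derive x v (fun y => N y *m M y) 0.
    apply: near_eq_is_derive (is_derive_cst (1%:M : 'M[R]_q) x v).
    by apply: filterS uM => y uMy; rewrite /= mulVmx.
  have := is_derive_mulmx dN' dM.
  rewrite mulmx0 addr0 Mx mul_mx_scalar => d2.
  have /eqP : 2 *: 'D_v N x = 0 by case: d1 => _ <-; case: d2 => _ <-.
  by rewrite scaler_eq0 pnatr_eq0 /= => /eqP.
have Nx : N x = 2^-1%:M by rewrite /N Mx invmx_scalar.
have dS : is_derive x v (fun y => l y + U) H.
  have := is_deriveD dl (is_derive_cst U x v).
  by move/is_derive_eq; apply; rewrite addr0.
have := is_deriveB (is_derive_mulmx (is_derive_mulmx dS dN0) (is_derive_tr dS))
   (is_derive_cst (1%:M : 'M[R]_p) x v).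
move/is_derive_eq; apply; rewrite subr0 mulmx0 addr0 Nx lx !mul_mx_scalar.
have -> : U + U = 2 *: U by rewrite scaler_nat mulr2n.
rewrite linearZ /= -scalemxAr -scalemxAl !scalerA.
by rewrite mulVf ?divff ?pnatr_eq0 // !scale1r.
Qed.

(** The reflection at the base frame is 2 U U^T - 1, which fixes U and changes
    the sign of its orthogonal complement; composing with it turns the symmetric
    derivative of the reflections into the skew one of a rotation. *)
Lemma frame_reflection_turn (U H : 'M[R]_(p, q)) :
  U^T *m U = 1%:M -> H^T *m U = 0 ->
  (H *m U^T + U *m H^T) *m frame_reflection U U = H *m U^T - U *m H^T.
Proof.
move=> UU HU; rewrite frame_reflection_self // mulmxBr mulmx1.
have -> : (H *m U^T + U *m H^T) *m (2 *: (U *m U^T)) = 2 *: (H *m U^T).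
  rewrite -scalemxAr mulmxA; congr (_ *: (_ *m _)).
  by rewrite mulmxDl -!mulmxA UU HU mulmx1 mulmx0 addr0.
by rewrite scaler_nat mulr2n opprD addrA addrK.
Qed.

(** The lift is the reflection from l x to l y, composed with the constant
    reflection at l x, so that it starts at Q. *)
Lemma smooth_frame_lift (V : normedModType R) (l : V -> 'M[R]_(p, q)) x
    (Q : 'M[R]_p) : (q <= p)%N ->
  smooth_near x l -> (\forall y \near x, (l y)^T *m l y = 1%:M) ->
  Q^T *m Q = 1%:M -> Q *m J = l x ->
  exists L : V -> 'M[R]_p,
    [/\ smooth_near x L, L x = Q,
        \forall y \near x, (L y)^T *m L y = 1%:M /\ L y *m J = l y &
        forall v H, is_derive x v l H -> (Q *m J)^T *m H = 0 ->
          is_derive x v L (flag_extension Q H)].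
Proof.
move=> qp [A [oA Cl]] ll QQ QJ; pose U := Q *m J.
have UU : U^T *m U = 1%:M.
  by rewrite /U trmx_mul -mulmxA [Q^T *m _]mulmxA QQ mul1mx pid_mx_tr_mul.
have M2 := add_scalar_mx1 q.
have u2 : 1%:M + U^T *m U \in unitmx.
  by rewrite UU M2 unitmxE det_scalar unitrX // unitfE pnatr_eq0.
pose M y := 1%:M + (l y)^T *m U.
have CM k : of_class_C k A M.
  case: oA => oA _; apply: of_class_CD => //; first exact: of_class_C_cst.
  apply: of_class_C_mulmx => //; last exact: of_class_C_cst.
  exact: of_class_C_tr.
have uM : M x \in unitmx by rewrite /M -QJ.
have [B [oB Bx] BA] := near_unitmx oA (CM 0%N) uM.
have nB : nbhs x B by exact: open_nbhs_nbhs.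
have ClB k : of_class_C k B l by apply: of_class_C_sub (Cl k) => y /BA[].
have CMB k : of_class_C k B M by apply: of_class_C_sub (CM k) => y /BA[].
have CN k : of_class_C k B (fun y => invmx (M y)).
  by apply: of_class_C_invmx => // y /BA[].
(* Reflecting twice at the base point gives the lift the value Q there. *)
pose S := frame_reflection U U *m Q.
have SJ : S *m J = U.
  by rewrite /S -mulmxA frame_reflection_frame.
exists (fun y => frame_reflection U (l y) *m S); split.
- exists B; split=> // k.
  apply: of_class_C_mulmx => //; last exact: of_class_C_cst.
  have CS : of_class_C k B (fun y => l y + U).
    by apply: of_class_CD => //; exact: of_class_C_cst.
  apply: of_class_CD => //; last exact: of_class_C_cst.
  apply: of_class_C_mulmx => //; last exact: of_class_C_tr.
  exact: of_class_C_mulmx.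
- rewrite -QJ -/U /S mulmxA.
  have GT : (frame_reflection U U)^T = frame_reflection U U.
    rewrite frame_reflection_self // [LHS]linearB /= linearZ /= trmx_mul.
    by rewrite trmxK trmx1.
  by rewrite -{1}GT frame_reflection_orthogonal // mul1mx.
- near=> y; have By : B y by near: y.
  have uMy : M y \in unitmx by case: (BA _ By).
  have lly : (l y)^T *m l y = 1%:M by near: y.
  rewrite -mulmxA SJ frame_reflection_frame //; split=> //.
  rewrite trmx_mul -mulmxA [_^T *m (_ *m S)]mulmxA.
  rewrite frame_reflection_orthogonal // mul1mx /S trmx_mul -mulmxA.
  by rewrite [_^T *m (_ *m Q)]mulmxA frame_reflection_orthogonal // mul1mx.
- move=> v H dl UH.
  have dG : is_derive x v (fun y => frame_reflection U (l y))
      (H *m U^T + U *m H^T).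
    apply: is_derive_frame_reflection => //.
      by near=> y; case: (BA y) => //; near: y.
    by apply: diff_derivable; case: (CN 1%N) => + _; exact.
  have := is_derive_mulmx dG (is_derive_cst S x v).
  move/is_derive_eq; apply; rewrite mulmx0 addr0 /S mulmxA /flag_extension.
  by congr (_ *m Q); apply: frame_reflection_turn => //;
     rewrite -[LHS]trmxK trmx_mul trmxK UH trmx0.
Unshelve. all: by end_near. Qed.

End FrameLift.

(** * Comparison of the two Riemannian structures *)

Section Transfer.
Context {R : realType} {p q : nat}.
Hypothesis qp : (q <= p)%N.
Local Notation J := (pid_mx q : 'M[R]_(p, q)).
Local Notation F := (flag_manifold R p [:: q]).
Local Notation G := (gr_manifold R p q).

Lemma col_span_pid_mx (Q : 'M[R]_p) : col_span (Q *m J) q = col_span Q q.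
Proof.
have colJ (j : 'I_q) : col j (Q *m J) = col (widen_ord qp j) Q.
  apply/colP => i; rewrite !mxE (bigD1 (widen_ord qp j)) //= big1 ?addr0.
    by rewrite !mxE /= eqxx ltn_ord mulr1.
  move=> l; rewrite !mxE -val_eqE /= => /negPf ->.
  by rewrite mulr0.
apply: eq_span => x; apply/mapP/mapP => -[j].
  rewrite mem_filter colJ => /andP[jq _] ->.
  by exists (widen_ord qp j); rewrite // mem_filter mem_enum /= ltn_ord.
rewrite mem_filter => /andP[jq _] ->; exists (Ordinal jq).
  by rewrite mem_filter mem_enum jq.
by rewrite colJ; congr (col _ Q); exact: val_inj.
Qed.

Lemma val_gr_subspace (V : grassmannian R p q) : val V = [:: gr_subspace V].
Proof.
rewrite /gr_subspace; have /andP[/eqP/(congr1 size)] := valP V.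
by rewrite size_map; case: (val V) => // a [].
Qed.

Lemma flag_representsP (Q : 'M[R]_p) (V : grassmannian R p q) :
  @rq_represents R F Q V <-> Q^T *m Q = 1%:M /\ @rq_represents R G (Q *m J) V.
Proof.
rewrite /= col_span_pid_mx val_gr_subspace; split=> [[QQ [->]]|[QQ [_ ->]]] //.
split=> //; split=> //.
by rewrite trmx_mul -mulmxA [Q^T *m _]mulmxA QQ mul1mx pid_mx_tr_mul.
Qed.

Lemma flag_horizontalP (Q Z : 'M[R]_p) : @rq_horizontal R F Q Z <->
  exists X, [/\ X^T = - X, off_diagonal (q := q) X & Z = Q *m X].
Proof.
by split=> -[X [XT /off_diagonalP Xoff ->]]; exists X; split.
Qed.

(** The second half records that w contains only pairs of an orthonormal frame
    and a horizontal matrix, so that every pair of w extends to the flag side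
    and w is determined by v. *)
Definition corresponding (v : tangent F) (w : tangent G) :=
  (forall Q Z : 'M[R]_p, v (Q, Z) <->
     [/\ Q^T *m Q = 1%:M, @rq_horizontal R F Q Z & w (Q *m J, Z *m J)]) /\
  (forall U H : 'M[R]_(p, q), w (U, H) ->
     U^T *m U = 1%:M /\ @rq_horizontal R G U H).

Lemma horizontal_frame (Q Z : 'M[R]_p) : Q^T *m Q = 1%:M ->
  @rq_horizontal R F Q Z -> @rq_horizontal R G (Q *m J) (Z *m J).
Proof.
move=> QQ /flag_horizontalP[X [XT Xoff ->]] /=.
rewrite trmx_mul !mulmxA -[_ *m Q^T *m Q]mulmxA QQ mulmx1.
exact: off_diagonal_corner.
Qed.

Lemma flag_extensionK (Q Z : 'M[R]_p) : Q^T *m Q = 1%:M ->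
  @rq_horizontal R F Q Z -> flag_extension Q (Z *m J) = Z.
Proof.
move=> QQ /flag_horizontalP[X [XT Xoff ->]].
exact: horizontal_extension.
Qed.

Lemma flag_extensionZ a (Q : 'M[R]_p) (H : 'M[R]_(p, q)) :
  flag_extension Q (a *: H) = a *: flag_extension Q H.
Proof.
rewrite /flag_extension linearZ /= -scalemxAr -scalemxAl -scalerBr.
by rewrite -scalemxAl.
Qed.

Lemma flag_extension_horizontal (Q : 'M[R]_p) (H : 'M[R]_(p, q)) :
  Q^T *m Q = 1%:M -> (Q *m J)^T *m H = 0 ->
  @rq_horizontal R F Q (flag_extension Q H).
Proof.
move=> QQ UH; apply/flag_horizontalP.
by have [X HX] := flag_extension_skew qp QQ UH; exists X.
Qed.

Lemma corresponding_extension v w (Q : 'M[R]_p) (H : 'M[R]_(p, q)) :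
  corresponding v w -> Q^T *m Q = 1%:M ->
  w (Q *m J, H) -> v (Q, flag_extension Q H).
Proof.
move=> [vw wok] QQ wH; have [_ UH] := wok _ _ wH.
apply/vw; split=> //; first exact: flag_extension_horizontal.
by rewrite flag_extension_frame.
Qed.

Lemma corresponding_lift v w (U H : 'M[R]_(p, q)) :
  corresponding v w -> w (U, H) ->
  exists2 Q : 'M[R]_p, Q^T *m Q = 1%:M & Q *m J = U.
Proof.
move=> [_ wok] /wok[UU _].
by have [Q [QQ QJ]] := orthonormal_completion qp UU; exists Q.
Qed.

(** Every frame has an orthogonal completion, above which all horizontal
    matrices of the Grassmannian extend; so nothing is lost in either
    direction. *)
Lemma corresponding_eq v w v' w' :
  corresponding v w -> corresponding v' w' -> v = v' <-> w = w'.
Proof.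
have sub v1 w1 v2 w2 : corresponding v1 w1 -> corresponding v2 w2 ->
    v1 = v2 -> w1 `<=` w2.
  move=> vw1 vw2 v12 [U H] wUH.
  have [Q QQ QJ] := corresponding_lift vw1 wUH.
  have [_ UH] := vw1.2 _ _ wUH.
  move: wUH; rewrite -QJ => /(corresponding_extension vw1 QQ).
  rewrite v12 => /(vw2.1 _ _) [_ _]; rewrite flag_extension_frame //.
  by rewrite QJ.
move=> vw vw'; split=> [vv'|ww'].
  by apply/seteqP; split; [exact: sub vv' | apply: sub (esym vv')].
apply/funext => -[Q Z]; apply/propext.
by split=> [/(vw.1 _ _)|/(vw'.1 _ _)] [QQ hZ wZ];
   [apply/vw'.1 | apply/vw.1]; split; rewrite // ?ww' // -ww'.
Qed.

Lemma corresponding_scale a v w : corresponding v w ->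
  corresponding (scale_tangent a v) (scale_tangent a w).
Proof.
move=> vw; split=> [Q Z|U H]; last first.
  move=> [[U0 H0] /vw.2[UU UH] [<- <-]] /=; split=> //.
  by rewrite -scalemxAr UH scaler0.
split=> [[[Q0 Z0] /(vw.1 _ _)[QQ hZ wZ] [<- <-]]|[QQ hZ [[U0 H0] wU []]]].
- split=> //; last by exists (Q0 *m J, Z0 *m J) => //=; rewrite scalemxAl.
  move/flag_horizontalP: hZ => [X [XT Xoff ->]].
  apply/flag_horizontalP; exists (a *: X); split.
  + by rewrite linearZ /= XT scalerN.
  + by rewrite /off_diagonal {1}Xoff scalerDr scalemxAl scalemxAr.
  + by rewrite scalemxAr.
- move=> /= U0E aH0; move: wU; rewrite U0E => wH.
  exists (Q, flag_extension Q H0).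
    exact: corresponding_extension vw QQ wH.
  by rewrite /= -flag_extensionZ aH0 (flag_extensionK QQ hZ).
Qed.

Lemma flag_metricE (Q Z1 Z2 : 'M[R]_p) : Q^T *m Q = 1%:M ->
  @rq_horizontal R F Q Z1 -> @rq_horizontal R F Q Z2 ->
  @rq_metric R F Q Z1 Z2 = @rq_metric R G (Q *m J) (Z1 *m J) (Z2 *m J).
Proof.
move=> QQ /flag_horizontalP[X1 [X1T _ ->]] /flag_horizontalP[X2 [X2T X2off ->]].
exact: horizontal_metric.
Qed.

Lemma corresponding_metric v w v' w' :
  corresponding v w -> corresponding v' w' ->
  tangent_metric v v' = tangent_metric w w'.
Proof.
move=> vw vw'; congr (xget _ _); apply/seteqP; split=> r.
  move=> [Q [Z1 [Z2 [/(vw.1 _ _)[QQ h1 w1] /(vw'.1 _ _)[_ h2 w2] ->]]]].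
  by exists (Q *m J), (Z1 *m J), (Z2 *m J); split=> //; exact: flag_metricE.
move=> [U [H1 [H2 [w1 w2 ->]]]].
have [Q QQ QJ] := corresponding_lift vw w1; rewrite -QJ in w1 w2 *.
have v1 := corresponding_extension vw QQ w1.
have v2 := corresponding_extension vw' QQ w2.
exists Q, (flag_extension Q H1), (flag_extension Q H2); split=> //.
have [_ UH1] := vw.2 _ _ w1; have [_ UH2] := vw'.2 _ _ w2.
rewrite flag_metricE //; first by rewrite !flag_extension_frame.
- exact: flag_extension_horizontal.
- exact: flag_extension_horizontal.
Qed.

Lemma smooth_lift_frame (V : normedModType R) (x : V)
    (phi : V -> grassmannian R p q) (L : V -> 'M[R]_p) :
  @smooth_lift_near R F V x phi L ->
  @smooth_lift_near R G V x phi (fun y => L y *m J).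
Proof.
move=> [[A [oA CL]] Lphi]; split.
  exists A; split=> // k; case: oA => oA _.
  by apply: of_class_C_mulmx => //; exact: of_class_C_cst.
by apply: filterS Lphi => y /flag_representsP[].
Qed.

Lemma smooth_lift_extend (V : normedModType R) (x : V)
    (phi : V -> grassmannian R p q) (l : V -> 'M[R]_(p, q)) (Q : 'M[R]_p) :
  @smooth_lift_near R G V x phi l -> Q^T *m Q = 1%:M -> Q *m J = l x ->
  exists L : V -> 'M[R]_p, [/\ @smooth_lift_near R F V x phi L, L x = Q &
    forall v H, is_derive x v l H -> (Q *m J)^T *m H = 0 ->
      is_derive x v L (flag_extension Q H)].
Proof.
move=> [sl lphi] QQ QJ.
have ll : \forall y \near x, (l y)^T *m l y = 1%:M.
  by apply: filterS lphi => y [].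
have [L [sL Lx LL dL]] := smooth_frame_lift qp sl ll QQ QJ.
exists L; split=> //; split=> //.
apply: filterS2 lphi LL => y /= lphiy [LLy LJ].
by apply/flag_representsP; split=> //; rewrite LJ.
Qed.

(** Lifts pass to frames by dropping columns, and back by [smooth_frame_lift],
    which realizes the horizontal derivative determined by its first columns. *)
Lemma velocity_corresponding (c : R -> grassmannian R p q) t :
  corresponding (@velocity R F c t) (@velocity R G c t).
Proof.
split=> [Q Z|U H]; last first.
  move=> [hH [l [[_ /nbhs_singleton lc] lt _]]]; split=> //.
  by move: lc => /=; rewrite lt => -[].
split.
- move=> [hZ [L [sL Lt dL]]].
  have [QQ _] : Q^T *m Q = 1%:M /\ @rq_represents R G (Q *m J) (c t).
    by apply/flag_representsP; case: sL => _ /nbhs_singleton; rewrite Lt.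
  split=> //; split; first exact: horizontal_frame.
  exists (fun s => L s *m J); split; [exact: smooth_lift_frame|by rewrite Lt|].
  have dL1 := is_derive1 (smooth_near_differentiable sL.1).
  have := is_derive_mulmx dL1 (is_derive_cst J t 1).
  by rewrite mulmx0 addr0 dL derive1E => -[].
- move=> [QQ hZ [hH [l [sl lt dl]]]]; split=> //.
  have [L [sL Lt dL]] := smooth_lift_extend sl QQ (esym lt).
  exists L; split=> //.
  have dl1 := is_derive1 (smooth_near_differentiable sl.1).
  rewrite dl in dl1.
  have [_] := dL _ _ dl1 hH.
  by rewrite derive1E => ->; exact: flag_extensionK.
Qed.

(** The two defining properties test the same derivatives of f along curves
    against inner products that agree, since velocities correspond. *)
Lemma gradient_corresponding (f : grassmannian R p q -> R) x :
  corresponding (@gradient R F f x) (@gradient R G f x).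
Proof.
split=> [Q Z|U H]; last by move=> [[]].
split.
- move=> [/flag_representsP[QQ QJx] hZ grad]; split=> //; split=> //.
    exact: horizontal_frame.
  move=> c H vH; have vc := velocity_corresponding c 0.
  have := grad c _ (corresponding_extension vc QQ vH).
  have [_ UH] := vc.2 _ _ vH.
  rewrite flag_metricE ?flag_extension_frame //.
  exact: flag_extension_horizontal.
- move=> [QQ hZ [QJx _ grad]]; split=> //; first by apply/flag_representsP.
  move=> c H vH; have [_ hH wH] := ((velocity_corresponding c 0).1 _ _).1 vH.
  by rewrite [rq_metric _ _ _](flag_metricE QQ hZ hH); exact: grad.
Qed.

(** An orthogonal completion of a frame lies above the same point, and its
    horizontal matrices are in bijection with those at the frame. *)
Lemma local_parametrization_flagE n (phi : 'rV[R]_n -> grassmannian R p q) x :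
  @local_parametrization R F n phi x <-> @local_parametrization R G n phi x.
Proof.
pose vc v := velocity_corresponding (fun s : R => phi (x + s *: v)) 0.
split=> -[[l sl] bij]; split.
- by exists (fun y => l y *m J); exact: smooth_lift_frame.
- move=> U H Ux UH; case: (Ux) => UU _.
  have [Q [QQ QJ]] := orthonormal_completion qp UU; subst U.
  have hZ := flag_extension_horizontal QQ UH.
  have Qx : @rq_represents R F Q (phi x) by apply/flag_representsP.
  have [v [vZ uniq]] := bij _ _ Qx hZ; exists v; split=> [|v'].
    by move/(vc v).1: vZ => [_ _]; rewrite flag_extension_frame.
  by move=> /(corresponding_extension (vc v') QQ); exact: uniq.
- have [UU _] := nbhs_singleton sl.2.
  have [Q [QQ QJ]] := orthonormal_completion qp UU.
  by have [L [sL _ _]] := smooth_lift_extend sl QQ QJ; exists L.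
- move=> Q Z /flag_representsP[QQ QJx] hZ.
  have [v [vZ uniq]] := bij _ _ QJx (horizontal_frame QQ hZ); exists v.
  split=> [|v' /(vc v').1 [_ _]]; last exact: uniq.
  by apply/(vc v).1.
Qed.

(** The symbols depend on the metric only through its coefficients, which are
    inner products of velocities of the same coordinate curves. *)
Lemma christoffel_flagE n (phi : 'rV[R]_n -> grassmannian R p q) :
  @christoffel R F n phi = @christoffel R G n phi.
Proof.
have metricE : @metric_coef R F n phi = @metric_coef R G n phi.
  apply/funext => x; apply/matrixP => i j; rewrite !mxE.
  exact: corresponding_metric (velocity_corresponding _ _)
    (velocity_corresponding _ _).
by rewrite /christoffel metricE.
Qed.

Lemma geodesic_flagE (c : R -> grassmannian R p q) :
  @geodesic R F c <-> @geodesic R G c.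
Proof.
split=> geo t; have [n [phi [u [pu su cu eu]]]] := geo t; exists n, phi, u.
  by split; [exact/local_parametrization_flagE | exact: su | exact: cu |
    rewrite -christoffel_flagE; exact: eu].
by split; [exact/local_parametrization_flagE | exact: su | exact: cu |
  rewrite christoffel_flagE; exact: eu].
Qed.

Lemma riem_exp_flagE x v w : corresponding v w ->
  @riem_exp R F x v = @riem_exp R G x w.
Proof.
move=> vw; congr (xget _ _); apply/seteqP; split=> y [c [geo c0 cv ->]];
  (exists c; split; [exact/geodesic_flagE | exact: c0 |
    exact/(corresponding_eq (velocity_corresponding c 0) vw) | by []]).
Qed.

Lemma grad_step_flagE a f x : @grad_step R F a f x = @grad_step R G a f x.
Proof. exact/riem_exp_flagE/corresponding_scale/gradient_corresponding. Qed.

(** * Comparison of the algorithms *)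

Lemma front_cost1 T (W : 'M[R]_(p, T)) :
  @front_cost R p T [:: q] W = @great_cost R p T q W.
Proof.
apply/funext => V; rewrite /front_cost /great_cost val_gr_subspace.
by rewrite big_seq1 invr1 scale1r.
Qed.

Lemma front_great T K w alpha t :
  @front R p [:: q] T K w alpha t = @great R p q T K w alpha t.
Proof.
rewrite /front /great front_cost1; congr (iter K _).
by apply/funext => x; exact: grad_step_flagE.
Qed.

End Transfer.

Theorem proposition3 (R : realType) (p q T K : nat)
    (hp : (2 <= p)%N) (hq0 : (0 < q)%N) (hqp : (q < p)%N)
    (hT : (1 <= T)%N) (hK : (1 <= K)%N)
    (w : nat -> 'cV[R]_p) (alpha : nat -> R)
    (halpha : forall t, (T.-1 <= t)%N -> 0 < alpha t) :
  @equivalent_algorithms (grassmannian R p q) T.-1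
    (@front R p [:: q] T K w alpha)
    (@great R p q T K w alpha).
Proof.
move=> x y xA yA xy t /ltnW/subnKC <-.
elim: (t - _)%N => [|n IH]; first by rewrite addn0.
rewrite addnS xA ?leq_addr // yA ?leq_addr // IH front_great //.
exact: ltnW.
Qed.
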